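(* Let $n>0$ and let $K$ be a finite $n$-dimensional simplicial complex equipped with a tiling $\mathcal{T}$. Then the sequence $\frac{1}{|h(\mathcal{T})|(n+1)!^d}h(\mathrm{Sd}^d(\mathcal{T}))$ converges to $h^n$ as $d$ grows to $+\infty$. Moreover, the matrix $\frac{1}{(n+1)!^d}H_n^d$ converges to $(1,\ldots,1)(h^n)^t$ as $d$ grows to $+\infty$, where $(1,\ldots,1)(h^n)^t$ denotes the $(n+2)\times(n+2)$ matrix all of whose rows are equal to $h^n$.
   Context: For $n>0$ and $s\in\{0,\ldots,n+1\}$, a tile of type $T_s^n$ is a closed $n$-simplex deprived of $s$ of its (closed) facets. A tiling $\mathcal{T}$ of an $n$-dimensional simplicial complex $K$ is a partition of $|K|$ into disjoint tiles, each of the form $\sigma$ deprived of $s$ of its facets for some $n$-simplex $\sigma$ of $K$. Its $h$-vector is $h(\mathcal{T})=(h_0(\mathcal{T}),\ldots,h_{n+1}(\mathcal{T}))$, $h_s(\mathcal{T})$ being the number of tiles of type $T_s^n$, and $|h(\mathcal{T})|=\sum_{s=0}^{n+1}h_s(\mathcal{T})$. Let $T_s^n=\Delta_n\setminus(\sigma_1\cup\cdots\cup\sigma_s)$, $\sigma_i$ facets of the standard simplex $\Delta_n$, and $\mathrm{Sd}(T_s^n)=\mathrm{Sd}(\Delta_n)\setminus\bigcup_{i=1}^s\mathrm{Sd}(\sigma_i)$, $\mathrm{Sd}$ being barycentric subdivision. A tiling of $\mathrm{Sd}(T_s^n)$ is a partition into tiles, each an $n$-simplex of $\mathrm{Sd}(\Delta_n)$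 deprived of some of its facets. $H_n$ is the $(n+2)\times(n+2)$ matrix whose $(s+1)$-st row, $s\in\{0,\ldots,n+1\}$, is the $h$-vector of a tiling of $\mathrm{Sd}(T_s^n)$ which contains exactly one tile $T_0^n$ if $s=0$ and none if $s>0$; such tilings exist and their $h$-vector does not depend on the choice. Equivalently, $H_0=\mathrm{Id}_2$ and, for $n\geq 0$ and $s\in\{1,\ldots,n+3\}$, the $s$-th row of $H_{n+1}$ is the sum of the first $s-1$ rows of $H_n$ each preceded by a $0$ and of the last $n+3-s$ rows of $H_n$ each followed by a $0$. $\mathrm{Sd}(\mathcal{T})$ is the tiling of $\mathrm{Sd}(K)$ obtained by subdividing each tile of $\mathcal{T}$ and tiling it by such a tiling of $\mathrm{Sd}(T_s^n)$, so that $h(\mathrm{Sd}(\mathcal{T}))=h(\mathcal{T})^tH_n$; $\mathrm{Sd}^d(\mathcal{T})$ is the $d$-fold iterate, a tiling of $\mathrm{Sd}^d(K)$. $h^n=(h_0^n,\ldots,h_{n+1}^n)$ is the eigenvector of the transposed matrix $H_n^t$ associated to the eigenvalue $(n+1)!$ (which is simple), normalized by $\sum_{s=0}^{n+1}h_s^n=1$. *)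

(* Defs.v *)
From HB Require Import structures.
From mathcomp Require Import all_boot all_order all_algebra.
From mathcomp Require Import boolp classical_sets reals topology.
From mathcomp Require Import normedtype sequences.

Set Implicit Arguments.
Unset Strict Implicit.
Unset Printing Implicit Defensive.

Import Order.TTheory GRing.Theory Num.Theory.
Import numFieldNormedType.Exports.

Local Open Scope classical_set_scope.
Local Open Scope ring_scope.

(* The pair (s, r) encodes the simplex s deprived of its facets s :\ v for v in
   r, i.e. of the facets opposite to the vertices of r. *)
Notation tile V := ({set V} * {set V})%type.

Section Complexes.
Variable V : finType.

(* Vertices lie in V, simplices are nonempty sets of vertices; an element of V
   need not be a vertex of K. *)
Definition simplicial_complex (K : {set {set V}}) : Prop :=
  finset.set0 \notin K /\
  (forall s t : {set V},
     s \in K -> t \subset s -> t != finset.set0 -> t \in K).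

Definition has_dim (n : nat) (K : {set {set V}}) : Prop :=
  (exists2 s, s \in K & #|s| = n.+1) /\
  (forall s, s \in K -> (#|s| <= n.+1)%N).

Definition faces (s : {set V}) : {set {set V}} :=
  [set t : {set V} | (t \subset s) && (t != finset.set0)]%SET.

(* The vertices of Sd K are the simplices of K (standing for their
   barycenters), its simplices the nonempty chains of simplices of K. *)
Definition Sd (K : {set {set V}}) : {set {set {set V}}} :=
  [set c : {set {set V}} | [&& c != finset.set0, c \subset K &
     [forall a in c, forall b in c, (a \subset b) || (b \subset a)]]]%SET.

Definition is_tile (n : nat) (K : {set {set V}}) (t : tile V) : Prop :=
  [/\ t.1 \in K, #|t.1| = n.+1 & t.2 \subset t.1].

Definition tile_type (t : tile V) : nat := #|t.2|.

Definition tile_count (T : {set tile V}) (s : nat) : nat :=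
  #|[set t in T | tile_type t == s]%SET|.

Section Realization.
Variable R : realType.

(* Points are given by barycentric coordinates. *)
Definition simplex_pts (s : {set V}) : set {ffun V -> R} :=
  [set x | [/\ forall v, 0 <= x v, \sum_v x v = 1 &
               forall v, v \notin s -> x v = 0]].

Definition complex_pts (K : {set {set V}}) : set {ffun V -> R} :=
  \bigcup_(s in [set` K]) simplex_pts s.

Definition tile_pts (t : tile V) : set {ffun V -> R} :=
  simplex_pts t.1 `\` \bigcup_(v in [set` t.2]) simplex_pts (t.1 :\ v)%SET.

(* T is a partition of the set of points A into n-dimensional tiles whose
   underlying simplices belong to K. *)
Definition tiles (n : nat) (K : {set {set V}}) (A : set {ffun V -> R})
    (T : {set tile V}) : Prop :=
  (forall t, t \in T -> is_tile n K t) /\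
  classical_sets.partition [set` T] tile_pts A.

Definition tiling (n : nat) (K : {set {set V}}) (T : {set tile V}) : Prop :=
  tiles n K (complex_pts K) T.

Definition hvec (n : nat) (T : {set tile V}) : 'cV[R]_n.+2 :=
  \col_(s < n.+2) (tile_count T s)%:R.

Definition hnorm (n : nat) (T : {set tile V}) : R :=
  \sum_(s < n.+2) hvec n T s ord0.

End Realization.
End Complexes.

(* The points of Sd t inside |Sd t.1|. *)
Definition Sd_tile_pts (R : realType) (V : finType) (t : tile V)
    : set {ffun {set V} -> R} :=
  complex_pts (Sd (faces t.1)) `\`
    \bigcup_(v in [set` t.2]) complex_pts (Sd (faces (t.1 :\ v)%SET)).

(* The tilings of Sd t used to subdivide a tile t: they contain exactly one
   tile of type 0 if t itself has type 0, and none otherwise. *)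
Definition Sd_tile_tiling (R : realType) (n : nat) (V : finType) (t : tile V)
    (U : {set tile {set V}}) : Prop :=
  tiles n (Sd (faces t.1)) (@Sd_tile_pts R V t) U /\
  tile_count U 0 = (tile_type t == 0)%N.

Definition Sd_tiling (R : realType) (n : nat) (V : finType)
    (T : {set tile V}) (T' : {set tile {set V}}) : Prop :=
  exists2 U : tile V -> {set tile {set V}},
    forall t, t \in T -> Sd_tile_tiling R n t (U t) &
    T' = (\bigcup_(t in T) U t)%SET.

(* The type containing the vertices of the d-th barycentric subdivision. *)
Fixpoint Sd_vertex (V : finType) (d : nat) : finType :=
  if d is d'.+1 then {set Sd_vertex V d'} else V.

(* Td d is a choice of the d-th subdivision of the tiling T. *)
Definition Sd_iterates (R : realType) (n : nat) (V : finType)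
    (T : {set tile V}) (Td : forall d, {set tile (Sd_vertex V d)}) : Prop :=
  Td 0%N = T /\ forall d, @Sd_tiling R n (Sd_vertex V d) (Td d) (Td d.+1).

(* H is the matrix H_n: row s is the h-vector of a tiling as above of the
   subdivision of a tile of type s of the standard n-simplex. *)
Definition is_Sd_matrix (R : realType) (n : nat) (H : 'M[R]_n.+2) : Prop :=
  forall s : 'I_n.+2,
    exists (r : {set 'I_n.+1}) (U : {set tile {set 'I_n.+1}}),
      [/\ #|r| = s,
          Sd_tile_tiling R n (([set: 'I_n.+1]%SET, r) : tile 'I_n.+1) U &
          row s H = (hvec R n U)^T].

(* h is the eigenvector h^n of the transpose of H = H_n. *)
Definition is_limit_hvec (R : realType) (n : nat) (H : 'M[R]_n.+2)
    (h : 'cV[R]_n.+2) : Prop :=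
  H^T *m h = (n.+1)`!%:R *: h /\ \sum_(s < n.+2) h s ord0 = 1.

(* Main.v *)
Require Import Defs.
From HB Require Import structures.
From mathcomp Require Import all_boot all_order all_algebra.
From mathcomp Require Import boolp classical_sets reals topology.
From mathcomp Require Import normedtype sequences.

Set Implicit Arguments.
Unset Strict Implicit.
Unset Printing Implicit Defensive.

Import Order.TTheory GRing.Theory Num.Theory.
Import numFieldNormedType.Exports.

Local Open Scope classical_set_scope.
Local Open Scope ring_scope.

(** Write N = (n+1)! and P = H / N. Everything follows from the convergence of
P^d to the matrix whose rows all equal h, which is a statement on Markov chains.

What has to be known about H is read off from face counts. A tile with vertex
set s and missing facets opposite to r is the union of the open faces c of s
that contain r, so it has C(n+1-|r|, n+1-k) open faces with k vertices. As
tiles are disjoint, a tiling with h-vector (a_0, ..., a_(n+1)) of a union of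
open faces satisfies
  f_k = sum_s a_s C(n+1-s, n+1-k)   for 0 < k <= n+1,
where f_k counts the open faces with k vertices. The system is triangular, so
the f_k and a_0 determine all the a_s ([face_counts_determine_hvec]). For the
subdivision of a tile, f_k counts chains of nonempty sets and depends only on
the type of the tile, while a_0 is prescribed; hence every tile of type s is
subdivided with h-vector the row s of H, in any complex ([Sd_matrixE]), and
h(Sd T) = H^t h(T) ([hvec_Sd_tiling]). To add up the contributions of the
tiles of T one needs that tilings of distinct tiles share no tile: a top
simplex of Sd K is a full flag, hence it remembers the simplex it subdivides.
The points of |K| enter only through barycenters of faces.

The extreme equations give the two facts needed on the entries of H.
For k = n+1 the right-hand side is the sum of the row, and f_(n+1) counts full
flags, whatever the type: all the rows of H have the same sum, which the
eigenvector h forces to be N ([Sd_matrix_sum_factorial]). So P is stochastic.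
For k = 1 the equation is f_1 = (n+1) a_0 + a_1. There is always a vertex, and
when a_0 = 1 there are 2^(n+1) - 1 > n+1 of them because n > 0; so column 1 of
H is positive ([Sd_matrix_col1]).

A stochastic matrix with a positive column contracts (Doeblin): subtracting
from P the constant e in that column leaves a nonnegative matrix Q with row
sums 1 - e, and the distance of P^d to its limit is governed by Q^d
([Doeblin_cvg]). *)

(** * Convergence of stochastic matrices *)

Lemma cvg_mx_coord (T : topologicalType) (m n : nat) (A : nat -> 'M[T]_(m, n))
    (B : 'M[T]_(m, n)) :
  (forall i j, (fun d => A d i j) @ \oo --> B i j) -> A @ \oo --> B.
Proof.
move=> AB X [P PB PX].
have : \forall d \near \oo, forall i j, P i j (A d i j).
  by apply: filter_forall => i; apply: filter_forall => j; apply: AB; apply: PB.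
by apply: filterS => d PA; apply: PX.
Qed.

Lemma cvg_lincomb (R : realType) (I : finType) (a l : I -> R)
    (u : I -> nat -> R) :
  (forall k, u k @ \oo --> l k) ->
  (fun d => \sum_k a k * u k d) @ \oo --> \sum_k a k * l k.
Proof.
move=> ul.
apply: (@cvg_big R I +%R 0 xpredT (@add_continuous R) nat \oo _
  (fun k d => a k * u k d)) => k _.
by apply: cvgM (ul k); apply: cvg_cst.
Qed.

Section Doeblin.
Variables (R : realType) (n : nat) (P : 'M[R]_n.+1) (h : 'cV[R]_n.+1).
Variables (j0 : 'I_n.+1) (e : R).
Hypotheses (P_ge0 : forall i j, 0 <= P i j).
Hypotheses (P_one : P *m const_mx 1 = const_mx 1 :> 'cV_n.+1).
Hypotheses (e_gt0 : 0 < e) (P_ge : forall i, e <= P i j0).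
Hypotheses (hP : h^T *m P = h^T) (h1 : \sum_i h i ord0 = 1).

Let one : 'cV[R]_n.+1 := const_mx 1.
Let Q : 'M[R]_n.+1 := P - e *: (one *m delta_mx ord0 j0).
Let Pi : 'M[R]_n.+1 := one *m h^T.

Let QE i j : Q i j = P i j - e * (j == j0)%:R.
Proof.
by rewrite !mxE big_ord1 !mxE mul1r eqxx.
Qed.

Let Q_ge0 i j : 0 <= Q i j.
Proof.
rewrite QE; case: eqP => [->|_]; first by rewrite mulr1 subr_ge0.
by rewrite mulr0 subr0.
Qed.

Let Q_one : Q *m one = (1 - e) *: one.
Proof.
rewrite mulmxBl P_one -scalemxAl -mulmxA.
suff -> : delta_mx ord0 j0 *m one = 1%:M :> 'M[R]_1 by rewrite mulmx1 scalerBl scale1r.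
apply/matrixP => i j; rewrite !ord1 !mxE (bigD1 j0) //= !mxE !eqxx mul1r big1 ?addr0 //.
by move=> k /negPf kj; rewrite !mxE kj andbF mul0r.
Qed.

Let QX_ge0 d i j : 0 <= (Q ^+ d) i j.
Proof.
elim: d i j => [|d IH] i j; first by rewrite expr0 mxE ler0n.
by rewrite exprS mxE sumr_ge0 // => k _; rewrite mulr_ge0.
Qed.

Let QX_one d : Q ^+ d *m one = (1 - e) ^+ d *: one.
Proof.
elim: d => [|d IH]; first by rewrite !expr0 mul1mx scale1r.
by rewrite exprSr -mulmxA Q_one -scalemxAr IH scalerA exprS.
Qed.

Let QX_le d i j : (Q ^+ d) i j <= (1 - e) ^+ d.
Proof.
have /matrixP/(_ i ord0) := QX_one d.
rewrite !mxE mulr1 => <-.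
rewrite (bigD1 j) //= mxE mulr1 lerDl sumr_ge0 // => k _.
by rewrite mxE mulr1.
Qed.

Let PX_one d : P ^+ d *m one = one.
Proof.
elim: d => [|d IH]; first by rewrite expr0 mul1mx.
by rewrite exprSr -mulmxA P_one IH.
Qed.

Let Pi_one : Pi *m one = one.
Proof.
rewrite -mulmxA (_ : h^T *m one = 1%:M) ?mulmx1 //.
apply/matrixP => i j; rewrite !ord1 !mxE -[RHS]h1; apply: eq_bigr => k _.
by rewrite !mxE mulr1.
Qed.

(** The matrix [1 - Pi] kills [one], so that multiplying it by [P] on the right
is the same as multiplying it by [Q]; the error [P ^+ d - Pi] has this property
as well, which propagates the formula to all powers. *)
Let Doeblin_error d : P ^+ d - Pi = (1 - Pi) * Q ^+ d.
Proof.
elim: d => [|d IH]; first by rewrite !expr0 mulr1.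
have Pierr : (P ^+ d - Pi) *m one = 0 by rewrite mulmxBl PX_one Pi_one subrr.
rewrite !exprSr mulrA -IH [RHS]mulmxBr -scalemxAr.
rewrite [(P ^+ d - Pi) *m (_ *m _)]mulmxA Pierr mul0mx scaler0 subr0.
by rewrite mulmxBl /Pi -mulmxA hP.
Qed.

(** Convergence is geometric, with ratio [1 - e]. *)
Lemma Doeblin_cvg i j : (fun d => (P ^+ d) i j) @ \oo --> h j ord0.
Proof.
have e_le1 : e <= 1.
  have /matrixP/(_ j0 ord0) := P_one; rewrite !mxE => <-.
  rewrite (bigD1 j0) //= mxE mulr1; apply: le_trans (P_ge j0) _.
  by rewrite lerDl sumr_ge0 // => k _; rewrite mxE mulr1.
have Q_cvg k l : (fun d => (Q ^+ d) k l) @ \oo --> (0 : R).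
  apply: (@squeeze_cvgr _ _ _ _ (fun=> 0) (fun d => (1 - e) ^+ d)).
  - by apply: nearW => d; rewrite QX_ge0 QX_le.
  - exact: cvg_cst.
  - by apply: cvg_expr; rewrite ger0_norm ?subr_ge0 // ltrBlDr ltrDl.
have -> : (fun d => (P ^+ d) i j) =
          (fun d => h j ord0 + \sum_k (1 - Pi) i k * (Q ^+ d) k j).
  apply/funext => d; have /eqP := Doeblin_error d; rewrite subr_eq => /eqP ->.
  rewrite mxE addrC; congr (_ + _); last by rewrite mxE.
  by rewrite mxE big_ord1 !mxE mul1r.
rewrite -[X in _ --> X]addr0; apply: cvgD; first exact: cvg_cst.
have sum0 : \sum_(k < n.+1) (1 - Pi) i k * 0 = 0 :> R.
  by rewrite big1 // => k _; rewrite mulr0.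
rewrite -[X in _ --> X]sum0.
exact: (@cvg_lincomb R _ (fun k => (1 - Pi) i k) (fun=> 0)
  (fun k d => (Q ^+ d) k j) (fun k => Q_cvg k j)).
Qed.

End Doeblin.

(** * Open faces of a tiling *)

Section Counting.
Import fintype boot.finset.
Variables (R : realType) (V : finType).
Implicit Types (s : {set V}) (t u : tile V) (K : {set {set V}}).

(** Barycenters stand for open faces: the barycenter of a face lies in a closed
simplex, a complex or a tile exactly when its open face does. *)
Definition barycenter s : {ffun V -> R} :=
  [ffun v => if v \in s then #|s|%:R^-1 else 0].

Lemma simplex_barycenter s s' : s != set0 ->
  simplex_pts s' (barycenter s) <-> s \subset s'.
Proof.
move=> s0; have card_s : #|s|%:R != 0 :> R by rewrite pnatr_eq0 cards_eq0.
split=> [[_ _ out] | /subsetP ss'].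
  apply/subsetP => v vs; apply: contraT => /out /eqP.
  by rewrite ffunE vs invr_eq0 (negPf card_s).
split=> [v||v vs'].
- by rewrite ffunE; case: ifP => // _; rewrite invr_ge0 ler0n.
- under eq_bigr do rewrite ffunE.
  by rewrite -big_mkcond /= sumr_const -[_^-1 *+ _]mulr_natl divff.
- by rewrite ffunE; case: ifP => // /ss' vs; rewrite vs in vs'.
Qed.

Lemma complex_barycenter K s : simplicial_complex K -> s != set0 ->
  @complex_pts V R K (barycenter s) <-> s \in K.
Proof.
move=> [_ Kdown] s0; split=> [[s' s'K /(simplex_barycenter _ s0) ss']|sK].
  exact: Kdown s'K ss' s0.
by exists s => //; apply/simplex_barycenter.
Qed.

Lemma tile_barycenter t s : s != set0 ->
  @tile_pts V R t (barycenter s) <-> (t.2 \subset s) && (s \subset t.1).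
Proof.
move=> s0; split=> [[/(simplex_barycenter _ s0) st out]|/andP[/subsetP ts st]].
  rewrite st andbT; apply/subsetP => v vt; apply: contraT => vs; case: out.
  by exists v => //; apply/simplex_barycenter => //; rewrite subsetD1 st.
split; first exact/simplex_barycenter.
by move=> [v /= /ts vs /(simplex_barycenter _ s0)]; rewrite subsetD1 vs andbF.
Qed.

(** Every tile contains the interior of its underlying simplex. *)
Lemma tiles_fst_inj n K A (T : {set tile V}) : @tiles V R n K A T ->
  {in T &, injective (fun t => t.1)}.
Proof.
move=> [Ttile [_ Tdisj _]] t t' tT t'T tt'; apply: Tdisj => //.
have [_ card_t t2] := Ttile _ tT; have [_ _ t'2] := Ttile _ t'T.
have t0 : t.1 != set0 by rewrite -cards_eq0 card_t.
exists (barycenter t.1); split; apply/tile_barycenter;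
  by rewrite // ?t2 ?tt' ?t'2 ?subxx.
Qed.

(** Complementation in [s] turns these sets into the subsets of [s :\: r] with
[n.+1 - k] elements. This form of the binomial coefficient is also right when
[k < #|r|], where both sides vanish. *)
Lemma card_subset_interval n k (r s : {set V}) :
  #|s| = n.+1 -> r \subset s -> (k <= n.+1)%N ->
  #|[set c : {set V} | [&& r \subset c, c \subset s & #|c| == k]]%SET|
    = 'C(n.+1 - #|r|, n.+1 - k).
Proof.
move=> card_s rs kn.
have card_D (c : {set V}) : c \subset s -> #|(s :\: c)%SET| = (n.+1 - #|c|)%N.
  by move=> cs; rewrite cardsD card_s (setIidPr cs).
have DK (c : {set V}) : c \subset s -> (s :\: (s :\: c))%SET = c.
  by move=> cs; rewrite setDDr setDv set0U (setIidPr cs).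
rewrite -(card_D _ rs) -cards_draws.
set D : {set {set V}} := [set c | _]%SET.
have <- : (setD s @: D)%SET
   = [set A : {set V} | (A \subset s :\: r) & #|A| == (n.+1 - k)%N]%SET.
  apply/setP => A; rewrite !inE; apply/imsetP/andP.
    move=> [c]; rewrite inE => /and3P[rc cs /eqP <-] ->.
    by rewrite card_D // setDS.
  rewrite subsetD => -[/andP[As Ar] /eqP cA]; exists (s :\: A)%SET; last first.
    by rewrite DK.
  by rewrite inE subsetD rs disjoint_sym Ar subsetDl card_D //= cA subKn.
rewrite card_in_imset // => c c'; rewrite !inE.
move=> /and3P[_ cs _] /and3P[_ c's _] cc'.
by rewrite -(DK c) // cc' DK.
Qed.

(** Double counting of the pairs (open face, tile containing it), when [A]
is the union of the open faces of the members of [F]. The bound [0 < k]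
excludes the empty set, which [F] may contain. *)
Lemma tiles_face_count n K A (T : {set tile V}) (F : {set {set V}}) k :
  @tiles V R n K A T -> (0 < k <= n.+1)%N ->
  (forall c : {set V}, c != set0 -> A (barycenter c) <-> c \in F) ->
  #|[set c in F | #|c| == k]%SET| =
  (\sum_(t in T) 'C(n.+1 - #|t.2|, n.+1 - k))%N.
Proof.
move=> TA /andP[k0 kn] AF; have [Ttile [Tcover Tdisj _]] := TA.
have nz (c : {set V}) : #|c| == k -> c != set0.
  by move=> /eqP ck; rewrite -cards_eq0 ck -lt0n.
transitivity (\sum_(t in T)
    #|[set c : {set V} | [&& t.2 \subset c, c \subset t.1 & #|c| == k]]%SET|)%N;
  last first.
  apply: eq_bigr => t tT; have [_ card_t t2] := Ttile t tT.
  exact: card_subset_interval.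
under eq_bigr do rewrite -sum1_card big_mkcond /=.
rewrite exchange_big /= -[LHS]sum1_card big_mkcond /=; apply: eq_bigr => c _.
rewrite inE; case: ifPn => [/andP[cF ck]|cF].
  have /(AF _ (nz _ ck)) : c \in F := cF.
  rewrite -Tcover => -[t tT /(tile_barycenter _ (nz _ ck)) ct].
  rewrite (bigD1 t) //= inE andbA ct ck big1 // => t' /andP[t'T t't].
  rewrite inE andbA; case: ifP => // /andP[ct' _].
  case/eqP: t't; apply: Tdisj => //.
  by exists (barycenter c); split; apply/tile_barycenter => //; exact: nz.
rewrite big1 // => t tT; rewrite inE andbA; case: ifP => // /andP[ct ck].
case/negP: cF; rewrite ck andbT; apply/AF; first exact: nz.
by rewrite -Tcover; exists t => //; apply/tile_barycenter => //; exact: nz.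
Qed.

Lemma sum_tile_count (M : pzSemiRingType) n (T : {set tile V}) (f : nat -> M) :
  (forall t, t \in T -> (#|t.2| <= n.+1)%N) ->
  \sum_(t in T) f #|t.2| = \sum_(s < n.+2) (tile_count T s)%:R * f s.
Proof.
move=> Tn; rewrite (partition_big (fun t => inord #|t.2| : 'I_n.+2) xpredT) //=.
apply: eq_bigr => s _; rewrite /tile_count -sum1_card natr_sum big_distrl /=.
apply: eq_big => [t|t /andP[tT /eqP <-]].
  rewrite inE; case: (boolP (t \in T)) => //= tT; rewrite -val_eqE /= inordK //.
  by rewrite ltnS Tn.
by rewrite mul1r inordK // ltnS Tn.
Qed.

End Counting.

(** * Faces of the subdivision of a tile *)

Section Chains.
Import fintype boot.finset.
Variables (R : realType) (V : finType).
Implicit Types (s : {set V}) (t : tile V) (c : {set {set V}}).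

Lemma Sd_complex (K : {set {set V}}) : simplicial_complex (Sd K).
Proof.
split=> [|c c']; first by rewrite inE eqxx.
rewrite !inE => /and3P[_ cK /forall_inP cch] c'c ->.
rewrite (subset_trans c'c cK) /=.
have {}c'c := subsetP c'c.
apply/forall_inP => a /c'c ac; apply/forall_inP => b /c'c bc.
exact: (forall_inP (cch a ac)).
Qed.

(** A chain lies in none of the subdivided facets opposite to the vertices of
[t.2] exactly when each of these vertices belongs to some member of it. *)
Definition Sd_tile_faces t : {set {set {set V}}} :=
  [set c in Sd (faces t.1) | [forall v in t.2, [exists a in c, v \in a]]]%SET.

Lemma Sd_tile_facesP t c : reflect
  [/\ c != set0, forall a, a \in c -> a \subset t.1 /\ a != set0,
      forall a b, a \in c -> b \in c -> (a \subset b) || (b \subset a) &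
      forall v, v \in t.2 -> exists2 a, a \in c & v \in a]
  (c \in Sd_tile_faces t).
Proof.
rewrite !inE -!andbA; apply: (iffP and4P) => -[c0 ct cch ctop]; split=> //.
- by move=> a /(subsetP ct); rewrite inE => /andP[].
- by move=> a b ac bc; exact: (forall_inP (forall_inP cch a ac)).
- by move=> v /(forall_inP ctop)/exists_inP.
- by apply/subsetP => a /ct [at1 a0]; rewrite inE at1 a0.
- by apply/forall_inP => a ac; apply/forall_inP => b bc; apply: cch.
- by apply/forall_inP => v /ctop ?; apply/exists_inP.
Qed.

Lemma Sd_tile_barycenter t c : c != set0 ->
  @Sd_tile_pts R V t (barycenter R c) <-> c \in Sd_tile_faces t.
Proof.
move=> c0; split.
  move=> [/(complex_barycenter _ (Sd_complex _) c0) cSd cout].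
  rewrite inE cSd; apply/forall_inP => v vt; apply: contraT => vc; case: cout.
  exists v => //; apply/(complex_barycenter _ (Sd_complex _) c0).
  move: cSd; rewrite !inE => /and3P[-> ct ->]; rewrite andbT /=.
  apply/subsetP => a ac; have := subsetP ct a ac.
  rewrite !inE => /andP[at1 ->]; rewrite andbT subsetD1 at1 /=.
  by apply: contra vc => va; apply/exists_inP; exists a.
rewrite inE => /andP[cSd /forall_inP ctop].
split; first by apply/(complex_barycenter _ (Sd_complex _) c0).
move=> [v /= vt /(complex_barycenter _ (Sd_complex _) c0)].
rewrite inE => /and3P[_ /subsetP ct _].
have /exists_inP[a ac va] := ctop v vt.
by have := ct a ac; rewrite inE subsetD1 va andbF.
Qed.

(** Members of a chain are told apart by their cardinals, which here exhaust
[1, ..., #|s|]. *)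
Lemma full_chain s c : (0 < #|s|)%N -> #|c| = #|s| ->
    (forall a, a \in c -> a \subset s /\ a != set0) ->
    (forall a b, a \in c -> b \in c -> (a \subset b) || (b \subset a)) ->
  s \in c.
Proof.
move=> s0 cs csub cch.
have card_inj : {in enum c &, injective (fun a : {set V} => #|a|)}.
  move=> a b; rewrite !mem_enum => ac bc ab.
  by case/orP: (cch a b ac bc) => ?; [|apply/esym]; apply/eqP;
    rewrite eqEcard ab leqnn andbT.
have card_mem : [seq #|a : {set V}| | a <- enum c] =i iota 1 #|s|.
  apply: (fun u v w => (uniq_min_size u v w).2).
  - by rewrite map_inj_in_uniq // enum_uniq.
  - move=> k /mapP[a]; rewrite mem_enum => /csub[/subset_leq_card a_s a0] ->.
    by rewrite mem_iota add1n ltnS a_s card_gt0 a0.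
  - by rewrite size_map size_iota -cardE cs.
have : #|s| \in iota 1 #|s| by rewrite mem_iota s0 add1n ltnS leqnn.
rewrite -card_mem => /mapP[a]; rewrite mem_enum => ac sa.
have [a_s _] := csub a ac.
suff -> : s = a by [].
by apply/esym/eqP; rewrite eqEcard a_s sa leqnn.
Qed.

End Chains.

Section FaceCount.
Import fintype boot.finset.

Lemma exists_inj_map (T T' : eqType) (l : seq T) (l' : seq T') (x' : T') :
  uniq l -> uniq l' -> size l = size l' ->
  exists2 f : T -> T', {in l &, injective f} & map f l = l'.
Proof.
move=> ul ul' ll'; exists (fun x => nth x' l' (index x l)).
  move=> x y xl yl /eqP; rewrite nth_uniq -?ll' ?index_mem // => /eqP.
  by move=> /(congr1 (nth x l)); rewrite !nth_index.
apply: (@eq_from_nth _ x'); rewrite size_map // => i il.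
have [x0 _] : exists x0 : T, True by case: {+}l il => // x0; exists x0.
by rewrite (nth_map x0) // index_uniq.
Qed.

(** Tiles of the same dimension and type are isomorphic. The simplex [t'.1] must
be nonempty because [f] is defined on all of [V]. *)
Lemma exists_tile_bij (V V' : finType) (t : tile V) (t' : tile V') :
    (0 < #|t'.1|)%N -> #|t.1| = #|t'.1| -> #|t.2| = #|t'.2| ->
    t.2 \subset t.1 -> t'.2 \subset t'.1 ->
  exists2 f : V -> V', {in t.1 &, injective f} &
    (f @: t.1 = t'.1)%SET /\ (f @: t.2 = t'.2)%SET.
Proof.
move=> t'0 e1 e2 t21 t'21; have /card_gt0P[x' _] := t'0.
pose l (W : finType) (u : tile W) := enum u.2 ++ enum (u.1 :\: u.2)%SET.
have mem_l W (u : tile W) : u.2 \subset u.1 -> l W u =i u.1.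
  move=> u21 x; rewrite mem_cat !mem_enum inE.
  by case: (boolP (x \in u.2)) => //= /(subsetP u21) ->.
have uniq_l W (u : tile W) : uniq (l W u).
  rewrite cat_uniq !enum_uniq andbT /=; apply/hasPn => x.
  by rewrite !mem_enum inE => /andP[].
have [|f finj] := exists_inj_map x' (uniq_l _ t) (uniq_l _ t').
  by rewrite !size_cat -!cardE !cardsD (setIidPr t21) (setIidPr t'21) e1 e2.
move=> fl; exists f; first by move=> x y; rewrite -!(mem_l _ t) //; apply: finj.
split; apply/setP => y.
  rewrite -mem_l // -fl; apply/imsetP/mapP => -[x xt ->]; exists x => //.
    by rewrite mem_l.
  by rewrite -mem_l.
have f2 : map f (enum t.2) = enum t'.2.
  move/eqP: fl; rewrite /l map_cat eqseq_cat; last by rewrite size_map -!cardE.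
  by move=> /andP[/eqP].
rewrite -[RHS]mem_enum -f2.
by apply/imsetP/mapP => -[x xt ->]; exists x => //; rewrite mem_enum in xt *.
Qed.

Definition Sd_face_count (V : finType) (t : tile V) (k : nat) : nat :=
  #|[set c in Sd_tile_faces t | #|c| == k]%SET|.

Lemma Sd_face_count_le (V V' : finType) (t : tile V) (t' : tile V') k :
    (0 < #|t'.1|)%N -> #|t.1| = #|t'.1| -> #|t.2| = #|t'.2| ->
    t.2 \subset t.1 -> t'.2 \subset t'.1 ->
  (Sd_face_count t k <= Sd_face_count t' k)%N.
Proof.
move=> t'0 e1 e2 t21 t'21.
have [f finj [f1 f2]] := exists_tile_bij t'0 e1 e2 t21 t'21.
pose F (c : {set {set V}}) := [set (f @: (a : {set V}))%SET | a in c]%SET.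
pose G (c : {set {set V'}}) :=
  [set (t.1 :&: f @^-1: (b : {set V'}))%SET | b in c]%SET.
have preimK (a : {set V}) : a \subset t.1 -> (t.1 :&: f @^-1: (f @: a))%SET = a.
  move=> /subsetP at1; apply/setP => x; rewrite !inE; apply/andP/idP.
    by move=> [xt /imsetP[y ya /finj ->]] //; apply: at1.
  by move=> xa; rewrite at1 // imset_f.
have FK : {in Sd_tile_faces t, cancel F G}.
  move=> c /Sd_tile_facesP[_ ct _ _]; rewrite /F /G -imset_comp -[RHS]imset_id.
  by apply: eq_in_imset => a /ct[/preimK].
have card_F : {in Sd_tile_faces t, forall c, #|F c| = #|c|}.
  move=> c /Sd_tile_facesP[_ ct _ _]; apply: card_in_imset => a b.
  by move=> /ct[/preimK Ka _] /ct[/preimK Kb _] fab; rewrite -Ka fab.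
rewrite /Sd_face_count -(@card_in_imset _ _ F); last first.
  move=> c c' /[1!in_set] /andP[cS _] /[1!in_set] /andP[c'S _].
  exact: (can_in_inj FK).
apply: subset_leq_card; apply/subsetP => _ /imsetP[c + ->].
move=> /[1!in_set] /andP[cS ck]; rewrite in_set card_F // ck andbT.
move: cS => /Sd_tile_facesP[c0 ct cch ctop]; apply/Sd_tile_facesP; split.
- have /set0Pn[a ac] := c0; apply/set0Pn; exists (f @: a)%SET.
  exact: imset_f.
- move=> _ /imsetP[a /ct[at1 a0] ->]; rewrite -f1 imsetS //; split=> //.
  by have /set0Pn[x xa] := a0; apply/set0Pn; exists (f x); apply: imset_f.
- move=> _ _ /imsetP[a ac ->] /imsetP[b bc ->].
  by case/orP: (cch a b ac bc) => ab; rewrite (imsetS f ab) ?orbT.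
- move=> _ /[!(esym f2)] /imsetP[v /ctop[a ac va] ->].
  by exists (f @: a)%SET; apply: imset_f.
Qed.

Lemma Sd_face_count_type (V V' : finType) (t : tile V) (t' : tile V') k :
    (0 < #|t'.1|)%N -> #|t.1| = #|t'.1| -> #|t.2| = #|t'.2| ->
    t.2 \subset t.1 -> t'.2 \subset t'.1 ->
  Sd_face_count t k = Sd_face_count t' k.
Proof.
move=> t'0 e1 e2 t21 t'21; apply/eqP.
by rewrite eqn_leq !Sd_face_count_le // e1.
Qed.

(** A flag with [#|s|] members contains [s] itself, hence it meets the interior of
[s] and avoids every facet. *)
Lemma Sd_flag_count (V : finType) (s r : {set V}) :
  (0 < #|s|)%N -> r \subset s ->
  Sd_face_count (s, r) #|s| = Sd_face_count (s, set0) #|s|.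
Proof.
move=> s0 rs; congr #|pred_of_set _|; apply/setP => c; rewrite !inE.
case: (boolP (#|c| == _)) => [/eqP cs|]; last by rewrite !andbF.
rewrite !andbT; case: (boolP [&& _, _ & _]) => //=.
move=> /and3P[_ /subsetP ct /forall_inP cch].
have sc : s \in c.
  apply: full_chain => // [a /ct|a b ac bc]; first by rewrite inE => /andP.
  exact: (forall_inP (cch a ac)).
transitivity true; last first.
  by apply/esym/forall_inP => v; rewrite inE.
by apply/forall_inP => v /(subsetP rs) vs; apply/exists_inP; exists s.
Qed.

(** The vertices are the nonempty subsets of [t.1] containing [t.2]: the set [t.1]
is always one of them, and all [2 ^ n.+1 - 1] nonempty subsets are when the tile
is a closed simplex. *)
Lemma Sd_vertex_count_ge (V : finType) n (t : tile V) :
    (0 < n)%N -> #|t.1| = n.+1 -> t.2 \subset t.1 ->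
  ((tile_type t == 0) * n.+1 < Sd_face_count t 1)%N.
Proof.
move=> n0 card_t t21.
have vertexP (a : {set V}) : a != set0 -> t.2 \subset a -> a \subset t.1 ->
    [set a]%SET \in [set c in Sd_tile_faces t | #|c| == 1%N]%SET.
  move=> a0 /subsetP t2a at1; rewrite inE cards1 eqxx andbT.
  apply/Sd_tile_facesP; split.
  - by apply/set0Pn; exists a; rewrite inE.
  - by move=> b /[1!inE] /eqP ->.
  - by move=> b b' /[1!inE] /eqP -> /[1!inE] /eqP ->; rewrite subxx.
  - by move=> v /t2a va; exists a => //; rewrite inE.
rewrite /tile_type; case: eqP => [/eqP|_]; last first.
  rewrite mul0n; apply/card_gt0P; exists [set t.1]%SET; apply: vertexP => //.
  by rewrite -card_gt0 card_t.
rewrite cards_eq0 mul1n => /eqP t20.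
apply: (@leq_trans #|(powerset t.1 :\ set0)%SET|).
  have := cardsD1 set0 (powerset t.1); rewrite card_powerset card_t inE sub0set add1n.
  move=> e; rewrite -ltnS -e expnS mul2n -addnn -(addn2 n.+1).
  have n_lt : (n < 2 ^ n)%N by apply: ltn_expl.
  by rewrite leq_add // (leq_ltn_trans n0 n_lt).
rewrite -(card_imset _ set1_inj); apply: subset_leq_card; apply/subsetP.
move=> _ /imsetP[a /setD1P[a0 /[1!powersetE] at1] ->].
by apply: vertexP => //; rewrite t20 sub0set.
Qed.

End FaceCount.

(** * The h-vector of a subdivided tiling *)

Section HVector.
Import fintype boot.finset.

(** The system is unitriangular: the coefficient of [a k] in the equation [k] is 1
and the one of [a s] vanishes for [s > k]. The missing equation [k = 0] is
replaced by the hypothesis on [a 0]. *)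
Lemma face_counts_determine_hvec n (a b : nat -> nat) : a 0%N = b 0%N ->
    (forall k, (0 < k <= n.+1)%N ->
      \sum_(s < n.+2) a s * 'C(n.+1 - s, n.+1 - k) =
      \sum_(s < n.+2) b s * 'C(n.+1 - s, n.+1 - k))%N ->
  forall k, (k <= n.+1)%N -> a k = b k.
Proof.
move=> ab0 ab k; elim/ltn_ind: k => -[//|k] IH kn.
pose k' : 'I_n.+2 := Ordinal (kn : (k.+1 < n.+2)%N).
have := ab k.+1 kn; rewrite (bigD1 k') //= [RHS](bigD1 k') //= binn !muln1.
rewrite (eq_bigr (fun s : 'I_n.+2 => b s * 'C(n.+1 - s, n.+1 - k.+1))%N); last first.
  move=> s sk; case: (ltngtP s k.+1) => [ltsk|gtsk|eqsk].
  - by rewrite (IH s ltsk) // ltnW // (leq_trans ltsk).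
  - by rewrite bin_small ?muln0 // ltn_sub2l // (leq_trans gtsk) // -ltnS.
  - by case/eqP: sk; apply: val_inj.
by move/addIn.
Qed.

Variable R : realType.

Lemma Sd_face_count_hvec (V : finType) n (t : tile V) (U : {set tile {set V}}) k :
    Sd_tile_tiling R n t U -> (0 < k <= n.+1)%N ->
  Sd_face_count t k = (\sum_(s < n.+2) tile_count U s * 'C(n.+1 - s, n.+1 - k))%N.
Proof.
move=> [Utiles _] kn.
rewrite /Sd_face_count (tiles_face_count Utiles kn (@Sd_tile_barycenter R V t)).
have [Utile _] := Utiles.
have Un u : u \in U -> (#|u.2| <= n.+1)%N.
  by move=> /Utile[_ <- u2]; exact: subset_leq_card.
have /= := sum_tile_count (fun s => 'C(n.+1 - s, n.+1 - k)) Un.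
by under [RHS]eq_bigr do rewrite natn.
Qed.

Lemma Sd_tile_count_type (V V' : finType) n (t : tile V) (t' : tile V') U U' j :
    #|t.1| = n.+1 -> #|t'.1| = n.+1 -> t.2 \subset t.1 -> t'.2 \subset t'.1 ->
    #|t.2| = #|t'.2| -> Sd_tile_tiling R n t U -> Sd_tile_tiling R n t' U' ->
    (j <= n.+1)%N ->
  tile_count U j = tile_count U' j.
Proof.
move=> e1 e1' t21 t'21 e2 HU HU'; apply: face_counts_determine_hvec.
  by rewrite HU.2 HU'.2 /tile_type e2.
move=> k kn; rewrite -(Sd_face_count_hvec HU kn) -(Sd_face_count_hvec HU' kn).
by apply: Sd_face_count_type; rewrite // ?e1 ?e1'.
Qed.

Variables (n : nat) (H : 'M[R]_n.+2).
Hypothesis HH : is_Sd_matrix H.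

Lemma Sd_matrixE (V : finType) (t : tile V) U (j : 'I_n.+2) :
    #|t.1| = n.+1 -> t.2 \subset t.1 -> Sd_tile_tiling R n t U ->
  (tile_count U j)%:R = H (inord #|t.2|) j.
Proof.
move=> e1 t21 HU; have [r [U' [er HU' rowH]]] := HH (inord #|t.2|).
have /matrixP/(_ ord0 j) := rowH; rewrite !mxE => ->; congr _%:R.
apply: (Sd_tile_count_type (t := t) (t' := (setT, r)) (n := n)) => //=.
- by rewrite cardsT card_ord.
- by rewrite er inordK // ltnS -e1 subset_leq_card.
- by rewrite -ltnS.
Qed.

Lemma Sd_matrix_row (s : 'I_n.+2) :
  exists (r : {set 'I_n.+1}) (U : {set tile {set 'I_n.+1}}),
    [/\ #|r| = s, Sd_tile_tiling R n (setT, r) U &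
        forall j, H s j = (tile_count U j)%:R].
Proof.
have [r [U [er HU rowH]]] := HH s; exists r, U; split=> // j.
by have /matrixP/(_ ord0 j) := rowH; rewrite !mxE.
Qed.

(** The equation for [k = n.+1]: all the binomial coefficients are 1 and the faces
are full flags. *)
Lemma Sd_matrix_sum s :
  \sum_j H s j = (Sd_face_count ([set: 'I_n.+1]%SET, set0) n.+1)%:R.
Proof.
have [r [U [_ HU HE]]] := Sd_matrix_row s.
have cT : #|[set: 'I_n.+1]%SET| = n.+1 by rewrite cardsT card_ord.
have := @Sd_flag_count _ [set: 'I_n.+1]%SET r; rewrite cT => <- //.
rewrite (Sd_face_count_hvec HU) ?leqnn // natr_sum; apply: eq_bigr => j _.
by rewrite HE subnn bin0 muln1.
Qed.

(** The equation for [k = 1]: only [s = 0] and [s = 1] contribute, so that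
[H s 1] is the number of vertices minus [n.+1] times [H s 0], and [H s 0] is
prescribed. *)
Lemma Sd_matrix_col1 s : (0 < n)%N -> 1 <= H s 1.
Proof.
move=> n0; have [r [U [_ HU HE]]] := Sd_matrix_row s.
rewrite HE ler1n.
have := @Sd_vertex_count_ge _ n ([set: 'I_n.+1]%SET, r) n0.
rewrite cardsT card_ord subsetT => /(_ erefl isT).
rewrite (Sd_face_count_hvec HU) // -HU.2 subn1 /= big_ord_recl big_ord_recl /=.
rewrite big1 ?addn0; last first.
  by move=> i _; rewrite bin_small ?muln0 // /bump /= subSS ltn_subrL n0.
by rewrite subn0 binSn /bump /= subn1 /= binn muln1 -[X in (X < _)%N]addn0
  ltn_add2l.
Qed.

(** This combinatorial trace of being a tiling passes from [T] to [Sd T] without any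
geometry of the points of [Sd K], and it suffices to add up h-vectors. *)
Definition distinct_tiles (V : finType) (T : {set tile V}) : Prop :=
  (forall t, t \in T -> #|t.1| = n.+1 /\ t.2 \subset t.1) /\
  {in T &, injective (fun t => t.1)}.

Lemma tiling_distinct (V : finType) K A (T : {set tile V}) :
  @tiles V R n K A T -> distinct_tiles T.
Proof.
move=> TA; split; last exact: tiles_fst_inj TA.
by case: TA => Ttile _ t /Ttile[].
Qed.

(** The vertices of a top simplex of [Sd t] form a full flag of [t.1]. *)
Lemma Sd_tile_tiling_support (V : finType) (t : tile V) U u :
    #|t.1| = n.+1 -> Sd_tile_tiling R n t U -> u \in U ->
  t.1 \in u.1 /\ forall a, a \in u.1 -> a \subset t.1.
Proof.
move=> e1 [[Utile _] _] /Utile[+ cu _].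
rewrite inE => /and3P[_ /subsetP ct /forall_inP cch].
have csub a : a \in u.1 -> a \subset t.1 /\ a != set0.
  by move=> /ct; rewrite inE => /andP.
split; last by move=> a /csub[].
apply: full_chain => //; rewrite ?e1 //.
by move=> a b ac bc; exact: (forall_inP (cch a ac)).
Qed.

Lemma Sd_tile_tiling_support_inj (V : finType) (t t' : tile V) U U' u u' :
    #|t.1| = n.+1 -> #|t'.1| = n.+1 ->
    Sd_tile_tiling R n t U -> Sd_tile_tiling R n t' U' ->
    u \in U -> u' \in U' -> u.1 = u'.1 ->
  t.1 = t'.1.
Proof.
move=> e1 e1' HU HU' uU u'U' uu'.
have [tu ut] := Sd_tile_tiling_support e1 HU uU.
have [t'u u't] := Sd_tile_tiling_support e1' HU' u'U'.
by apply/eqP; rewrite eqEsubset u't -?uu' // ut // uu'.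
Qed.

Lemma Sd_tiling_distinct (V : finType) (T : {set tile V}) T' :
  distinct_tiles T -> Sd_tiling R n T T' -> distinct_tiles T'.
Proof.
move=> [Ttile Tinj] [U HU ->]; split.
  move=> u /bigcupP[t tT uU]; have [[Utile _] _] := HU t tT.
  by have [] := Utile u uU.
move=> u u' /bigcupP[t tT uU] /bigcupP[t' t'T u'U] uu'.
have tt' : t = t'.
  apply: Tinj => //.
  apply: (Sd_tile_tiling_support_inj _ _ (HU t tT) (HU t' t'T) uU u'U uu').
    exact: (Ttile t tT).1.
  exact: (Ttile t' t'T).1.
subst t'; have [HUt _] := HU t tT.
exact: (tiles_fst_inj HUt).
Qed.

Lemma hvec_Sd_tiling (V : finType) (T : {set tile V}) T' :
  distinct_tiles T -> Sd_tiling R n T T' -> hvec R n T' = H^T *m hvec R n T.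
Proof.
move=> [Ttile Tinj] [U HU ->]; apply/colP => j; rewrite !mxE.
(* Extending [U] by the empty set makes the union one over all tiles, as
   [partition_disjoint_bigcup] requires. *)
pose F t := if t \in T then U t else set0.
have disjF t t' : t != t' -> [disjoint F t & F t']%B.
  move=> tt'; rewrite -setI_eq0; apply: contraNT tt' => /set0Pn[u].
  rewrite inE /F; case: ifP => [tT|]; last by rewrite inE.
  case: ifP => [t'T /andP[uU uU']|]; last by rewrite inE andbF.
  apply/eqP/Tinj => //.
  apply: (Sd_tile_tiling_support_inj _ _ (HU t tT) (HU t' t'T) uU uU') => //.
    exact: (Ttile t tT).1.
  exact: (Ttile t' t'T).1.
have tcE W (S : {set tile W}) : (tile_count S j)%:R = \sum_(u in S) (#|u.2| == j)%:R :> R.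
  rewrite /tile_count -sum1_card natr_sum [LHS]big_mkcond [RHS]big_mkcond /=.
  by apply: eq_bigr => u _; rewrite inE /tile_type; case: (u \in S); case: eqP.
have -> : (\bigcup_(t in T) U t)%SET = (\bigcup_t F t)%SET by rewrite big_mkcond.
rewrite tcE partition_disjoint_bigcup // /F.
transitivity (\sum_(t in T) H (inord #|t.2|) j).
  rewrite [RHS]big_mkcond; apply: eq_bigr => t _.
  case: ifP => [tT|_]; last by rewrite big_set0.
  rewrite -tcE; have [e1 t21] := Ttile t tT.
  exact: Sd_matrixE e1 t21 (HU t tT).
rewrite (sum_tile_count (n := n) (fun s => H (inord s) j)); last first.
  by move=> t /Ttile[<-]; apply: subset_leq_card.
by apply: eq_bigr => s _; rewrite !mxE inord_val mulrC.
Qed.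

Lemma hvec_Sd_iterates (V : finType) (T : {set tile V}) Td :
  distinct_tiles T -> Sd_iterates R n T Td ->
  forall d, hvec R n (Td d) = (H ^+ d)^T *m hvec R n T.
Proof.
move=> Tdist [T0 TS] d.
have Tddist k : distinct_tiles (Td k).
  by elim: k => [|k]; [rewrite T0 | move/Sd_tiling_distinct; apply].
elim: d => [|d IH]; first by rewrite T0 expr0 trmx1 mul1mx.
by rewrite (hvec_Sd_tiling (Tddist d) (TS d)) IH mulmxA exprSr -trmx_mul.
Qed.

End HVector.

(** * The limit *)

(** Summing the entries of [H^T *m h = N *: h] multiplies the sum 1 of the entries
of [h] by the common row sum of [H] on the left and by [N] on the right; this
avoids counting the full flags of a simplex. *)
Lemma Sd_matrix_sum_factorial (R : realType) n (H : 'M[R]_n.+2)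
    (h : 'cV[R]_n.+2) :
  is_Sd_matrix H -> is_limit_hvec H h -> forall s, \sum_j H s j = (n.+1)`!%:R.
Proof.
move=> HH [Hh h1] s; rewrite (Sd_matrix_sum HH); set N := _%:R.
transitivity (\sum_j (H^T *m h) j ord0).
  under eq_bigr do rewrite mxE.
  rewrite exchange_big /= -[LHS]mulr1 -h1 mulr_sumr; apply: eq_bigr => i _.
  rewrite /N -(Sd_matrix_sum HH i) mulr_suml.
  by apply: eq_bigr => j _; rewrite mxE.
rewrite Hh; under eq_bigr do rewrite mxE.
by rewrite -mulr_sumr h1 mulr1.
Qed.

Lemma hnorm_neq0 (R : realType) (n : nat) (V : finType) (K : {set {set V}})
    (T : {set tile V}) :
  has_dim n K -> tiling R n K T -> hnorm R n T != 0.
Proof.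
move=> [[s sK cs] _] [Ttile [Tcover _ _]].
have s0 : s != finset.set0 by rewrite -cards_eq0 cs.
have [t tT _] : classical_sets.cover [set` T] (@tile_pts V R) (barycenter R s).
  by rewrite Tcover; exists s => //; apply/simplex_barycenter.
have [_ ct /fintype.subset_leq_card] := Ttile t tT; rewrite ct -ltnS => t2.
rewrite /hnorm (bigD1 (Ordinal t2)) //= gt_eqF // ltr_pwDl //; last first.
  by apply: sumr_ge0 => i _; rewrite mxE ler0n.
rewrite mxE ltr0n; apply/card_gt0P; exists t.
by rewrite inE tT /tile_type eqxx.
Qed.

Theorem theorem1p11 (R : realType) (n : nat) (n_gt0 : (0 < n)%N)
    (H : 'M[R]_n.+2) (HH : is_Sd_matrix H)
    (h : 'cV[R]_n.+2) (hh : is_limit_hvec H h) :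
  (forall (V : finType) (K : {set {set V}}) (T : {set tile V})
      (Td : forall d : nat, {set tile (Sd_vertex V d)}),
    simplicial_complex K -> has_dim n K -> tiling R n K T ->
    Sd_iterates R n T Td ->
    (fun d : nat => (hnorm R n T * (n.+1)`!%:R ^+ d)^-1 *: hvec R n (Td d))
      @ \oo --> h)
  /\
  (fun d : nat => ((n.+1)`!%:R ^+ d)^-1 *: H ^+ d) @ \oo
    --> const_mx 1 *m h^T.
Proof.
set N : R := (n.+1)`!%:R.
have N_gt0 : 0 < N by rewrite ltr0n fact_gt0.
pose P := N^-1 *: H.
have PX d : P ^+ d = (N ^+ d)^-1 *: H ^+ d by rewrite exprZn exprVn.
have PX_cvg i j : (fun d => (P ^+ d) i j) @ \oo --> h j ord0.
  apply: (@Doeblin_cvg R n.+1 P h 1 N^-1).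
  - move=> k l; have [r [U [_ _ HE]]] := Sd_matrix_row HH k.
    by rewrite mxE HE mulr_ge0 ?ler0n // invr_ge0 ltW.
  - apply/colP => k; rewrite !mxE.
    under eq_bigr do rewrite !mxE mulr1.
    by rewrite -mulr_sumr (Sd_matrix_sum_factorial HH hh) mulVf // gt_eqF.
  - by rewrite invr_gt0.
  - by move=> k; rewrite mxE ler_peMr ?invr_ge0 ?(ltW N_gt0) // Sd_matrix_col1.
  - apply: trmx_inj; rewrite trmx_mul trmxK linearZ /= -scalemxAl hh.1 scalerA.
    by rewrite mulVf ?scale1r // gt_eqF.
  - exact: hh.2.
split; last first.
  apply: cvg_mx_coord => i j; rewrite mxE big_ord1 !mxE mul1r.
  by under eq_fun do rewrite -PX; exact: PX_cvg.
move=> V K T Td _ Kdim TK TTd; apply: cvg_mx_coord => i j; rewrite ord1 {j}.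
have T0 := hnorm_neq0 Kdim TK.
pose a (k : 'I_n.+2) := (hnorm R n T)^-1 * hvec R n T k ord0.
have -> : (fun d => ((hnorm R n T * N ^+ d)^-1 *: hvec R n (Td d)) i ord0) =
          (fun d => \sum_k a k * (P ^+ d) k i).
  apply/funext => d; rewrite (hvec_Sd_iterates HH (tiling_distinct TK) TTd).
  rewrite mxE mxE mulr_sumr; apply: eq_bigr => k _.
  have -> : (P ^+ d) k i = (N ^+ d)^-1 * (H ^+ d) k i by rewrite PX mxE.
  by rewrite /a [(H ^+ d)^T _ _]mxE invfM
    [X in _ * X = _]mulrC mulrACA.
have sum_a : \sum_k a k * h i ord0 = h i ord0.
  by rewrite -mulr_suml -mulr_sumr mulVf // mul1r.
rewrite -[X in _ --> X]sum_a.
exact: (@cvg_lincomb R _ a (fun=> h i ord0) (fun k d => (P ^+ d) k i)).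
Qed.
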